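(* Let $S$, $T$ be semigroups and let $(s,t,\alpha,\beta)$ be a pentagon quadruple, where $s(a,b)=(ab,\theta^S_a(b))$ is a PE solution on $S$ and $t(u,v)=(\theta^T_v(u),vu)$ is a reversed solution on $T$. Then the map $r:(S\times T)^2\to(S\times T)^2$ defined by $$r\big((a,u),(b,v)\big)=\Big(\big(\theta^S_a(\alpha_u(b)),\ v\,\beta_b(u)\big),\ \big(a\,\alpha_u(b),\ \theta^T_v(\beta_b(u))\big)\Big)$$ for all $a,b\in S$ and $u,v\in T$ is a YBE solution on $S\times T$.
   Context: For a set $X$ and a map $f:X\times X\to X\times X$, put $f_{12}=f\times \mathrm{id}_X$, $f_{23}=\mathrm{id}_X\times f$, $f_{13}=(\mathrm{id}_X\times\tau)f_{12}(\mathrm{id}_X\times\tau)$, where $\tau(x,y)=(y,x)$; juxtaposition of maps is composition, rightmost map applied first. The map $f$ is: - a PE solution (solution of the pentagon equation) on $X$ if $f_{23}f_{13}f_{12}=f_{12}f_{23}$; - a reversed solution (solution of the reversed pentagon equation) on $X$ if $f_{12}f_{13}f_{23}=f_{23}f_{12}$; - a YBE solution (solution of the braid equation) on $X$ if $f_{23}f_{12}f_{23}=f_{12}f_{23}f_{12}$. On a semigroup $S$, a PE solution is written $s(a,b)=(ab,\theta^S_a(b))$, and on a semigroup $T$ a reversed solution is written $t(u,v)=(\theta^T_v(u),vu)$, where the products are those of the semigroups and $\theta^S_a:S\to S$, $\theta^T_u:T\to T$ are maps. Pentagon quadruple: let $S,T$ be semigroups, $s(a,b)=(ab,\theta^S_a(b))$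 a PE solution on $S$, $t(u,v)=(\theta^T_v(u),vu)$ a reversed solution on $T$, and $\alpha:T\to S^S$, $\beta:S\to T^T$ maps (where $X^X$ is the set of all maps $X\to X$), with $\alpha_u=\alpha(u)$, $\beta_a=\beta(a)$. Then $(s,t,\alpha,\beta)$ is a pentagon quadruple if the following hold for all $a,b,c\in S$ and $u,v,w\in T$: (p1) $a\,\alpha_u(b)\,\alpha_{\theta^T_v\beta_b(u)}(c)=a\,\theta^S_b(\alpha_v(c))\,\alpha_u(b)\,\alpha_{\theta^T_v\beta_b(u)}(c)$; (r1) $u\,\beta_a(v)\,\beta_{\theta^S_b\alpha_v(a)}(w)=u\,\theta^T_v(\beta_b(w))\,\beta_a(v)\,\beta_{\theta^S_b\alpha_v(a)}(w)$; (p2) $\theta^S_a\theta^S_b\alpha_u=\theta^S_{\alpha_v(b)}\,\alpha_{\theta^T_u\beta_b(v)}$; (r2) $\theta^T_u\theta^T_v\beta_a=\theta^T_{\beta_b(v)}\,\beta_{\theta^S_a\alpha_v(b)}$; (p3) $\theta^S_a(bc)=\theta^S_{a\,\theta^S_b\alpha_u(c)}(bc)$; (r3) $\theta^T_u(vw)=\theta^T_{u\,\theta^T_v\beta_a(w)}(vw)$; (p4) $\alpha_u(a)\,\alpha_{\theta^T_v\beta_a(u)}(b)=\alpha_{x}\big(a\,\alpha_v(b)\big)$, where $x=\theta^T_{w\,\beta_b(v)}\big(\beta_{\theta^S_a\alpha_v(b)}(u)\big)\in T$; (r4) $\beta_a(u)\,\beta_{\theta^S_b\alpha_u(a)}(v)=\beta_{y}\big(u\,\beta_b(v)\big)$,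 where $y=\theta^S_{c\,\alpha_v(b)}\big(\alpha_{\theta^T_u\beta_b(v)}(a)\big)\in S$; (p5) $\theta^S_a=\alpha_u\theta^S_a$; (r5) $\theta^T_u=\beta_a\theta^T_u$. (Here expressions such as $\theta^T_v\beta_b(u)$ mean $\theta^T_v(\beta_b(u))$.) *)

(* Defs.v *)
From mathcomp Require Import all_boot.

Set Implicit Arguments.
Unset Strict Implicit.
Unset Printing Implicit Defensive.

Local Open Scope group_scope.

(* The triple product X * X * X is (X * X) * X.  Equalities of maps are
   pointwise equalities (=1), so that no extensionality axiom is needed. *)

Section PentagonBraid.
Context {X : Type}.
Implicit Type f : X * X -> X * X.

Definition flip (p : X * X) : X * X := (p.2, p.1).

Definition on12 f (p : X * X * X) : X * X * X := (f p.1, p.2).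

Definition on23 f (p : X * X * X) : X * X * X :=
  let q := f (p.1.2, p.2) in (p.1.1, q.1, q.2).

Definition on13 f : X * X * X -> X * X * X :=
  on23 flip \o on12 f \o on23 flip.

Definition pentagon_solution f : Prop :=
  on23 f \o on13 f \o on12 f =1 on12 f \o on23 f.

Definition reversed_pentagon_solution f : Prop :=
  on12 f \o on13 f \o on23 f =1 on23 f \o on12 f.

Definition braid_solution f : Prop :=
  on23 f \o on12 f \o on23 f =1 on12 f \o on23 f \o on12 f.

End PentagonBraid.

(* magmaType is used, with associativity as a separate hypothesis, because
   semigroupType also requires a choiceType structure on the carrier. *)

Definition pentagon_map (S : magmaType) (theta : S -> S -> S)
    (p : S * S) : S * S :=
  (p.1 * p.2, theta p.1 p.2).

Definition reversed_pentagon_map (T : magmaType) (theta : T -> T -> T)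
    (p : T * T) : T * T :=
  (theta p.2 p.1, p.2 * p.1).

(* A first argument written as a subscript in the usual notation comes first:
   thetaS a b is theta^S_a(b) and alpha u b is alpha_u(b).  The maps
   s(a, b) = (ab, theta^S_a(b)) and t(u, v) = (theta^T_v(u), vu) enter through
   thetaS and thetaT, which they determine and are determined by. *)
Record pentagon_quadruple (S T : magmaType)
    (thetaS : S -> S -> S) (thetaT : T -> T -> T)
    (alpha : T -> S -> S) (beta : S -> T -> T) : Prop := PentagonQuadruple {
  pq_s : pentagon_solution (pentagon_map thetaS);
  pq_t : reversed_pentagon_solution (reversed_pentagon_map thetaT);
  pq_p1 : forall (a b c : S) (u v : T),
    a * alpha u b * alpha (thetaT v (beta b u)) c =
    a * thetaS b (alpha v c) * alpha u b * alpha (thetaT v (beta b u)) c;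
  pq_r1 : forall (a b : S) (u v w : T),
    u * beta a v * beta (thetaS b (alpha v a)) w =
    u * thetaT v (beta b w) * beta a v * beta (thetaS b (alpha v a)) w;
  pq_p2 : forall (a b : S) (u v : T),
    thetaS a \o thetaS b \o alpha u =1
    thetaS (alpha v b) \o alpha (thetaT u (beta b v));
  pq_r2 : forall (a b : S) (u v : T),
    thetaT u \o thetaT v \o beta a =1
    thetaT (beta b v) \o beta (thetaS a (alpha v b));
  pq_p3 : forall (a b c : S) (u : T),
    thetaS a (b * c) = thetaS (a * thetaS b (alpha u c)) (b * c);
  pq_r3 : forall (a : S) (u v w : T),
    thetaT u (v * w) = thetaT (u * thetaT v (beta a w)) (v * w);
  pq_p4 : forall (a b : S) (u v w : T),
    alpha u a * alpha (thetaT v (beta a u)) b =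
    alpha (thetaT (w * beta b v) (beta (thetaS a (alpha v b)) u))
          (a * alpha v b);
  pq_r4 : forall (a b c : S) (u v : T),
    beta a u * beta (thetaS b (alpha u a)) v =
    beta (thetaS (c * alpha v b) (alpha (thetaT u (beta b v)) a))
         (u * beta b v);
  pq_p5 : forall (a : S) (u : T), thetaS a =1 alpha u \o thetaS a;
  pq_r5 : forall (a : S) (u : T), thetaT u =1 beta a \o thetaT u
}.

Definition quadruple_map (S T : magmaType)
    (thetaS : S -> S -> S) (thetaT : T -> T -> T)
    (alpha : T -> S -> S) (beta : S -> T -> T)
    (p : (S * T) * (S * T)) : (S * T) * (S * T) :=
  let: ((a, u), (b, v)) := p in
  ((thetaS a (alpha u b), v * beta b u),
   (a * alpha u b, thetaT v (beta b u))).

(* Main.v *)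
Require Import Defs.
From mathcomp Require Import all_boot.

(** Braid relation for the map of a pentagon quadruple.

    The hypotheses are invariant under exchanging (S, thetaS, alpha) with
    (T, thetaT, beta); on maps the exchange is conjugation by
    ((a, u), (b, v)) |-> ((v, b), (u, a)), which reverses the order of the
    legs and therefore turns one side of the braid relation into the other.
    Hence it is enough to compare the three S-components of the two sides
    ([braid_fst_components]); the T-components are those of the dual
    quadruple.

    In S, write B = alpha_u(b), C = alpha_{thetaT_v(beta_b(u))}(c) and
    e = thetaS_b(alpha_v(c)).  After [pq_p5] and [pq_p4], the two triples are
      (thetaS_a(e), thetaS_{a e}(B C), a e B C)   and
      (thetaS_{thetaS_a(B)}(thetaS_{a B}(C)), thetaS_a(B) thetaS_{a B}(C),
       a B C).
    The first entries agree by [pq_p2] and the pentagon equation, the last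
    ones by [pq_p1].  For the middle entries, the key fact is that on the
    images of the maps alpha_u, thetaS_b does not change when b is multiplied
    on the left, and its values there are fixed by every thetaS_a
    ([theta_alpha_mull] and [theta_fix_theta_alpha]).  Thus thetaS_B(C) = e,
    both entries have the form thetaS_x(B) e with x = a e or x = a, and
    [pq_p3] for the product B e identifies them. *)

Set Implicit Arguments.
Unset Strict Implicit.
Unset Printing Implicit Defensive.

Local Open Scope group_scope.

Lemma pentagon_mapP (S : magmaType) (theta : S -> S -> S) :
  pentagon_solution (pentagon_map theta) ->
  forall a b c : S,
    [/\ a * b * c = a * (b * c),
        theta a b * theta (a * b) c = theta a (b * c) &
        theta (theta a b) (theta (a * b) c) = theta b c].
Proof. by move=> sP a b c; case: (sP (a, b, c)). Qed.

(** Reversing the order of the three legs turns the reversed pentagon equation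
    for t(u, v) = (theta_v(u), vu) into the pentagon equation. *)
Lemma reversed_pentagon_map_dual (T : magmaType) (theta : T -> T -> T) :
  reversed_pentagon_solution (reversed_pentagon_map theta) <->
  pentagon_solution (pentagon_map theta).
Proof.
by split=> sP [[u v] w]; case: (sP (w, v, u)) => /= E1 E2 E3;
  rewrite /on13 /on12 /on23 /pentagon_map /reversed_pentagon_map /= E1 E2 E3.
Qed.

Lemma pentagon_quadruple_dual (S T : magmaType)
    (thetaS : S -> S -> S) (thetaT : T -> T -> T)
    (alpha : T -> S -> S) (beta : S -> T -> T) :
  pentagon_quadruple thetaS thetaT alpha beta ->
  pentagon_quadruple thetaT thetaS beta alpha.
Proof.
move=> [s t p1 r1 p2 r2 p3 r3 p4 r4 p5 r5]; split.
- exact/reversed_pentagon_map_dual.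
- exact/reversed_pentagon_map_dual.
- by move=> *; apply: r1.
- by move=> *; apply: p1.
- by move=> *; apply: r2.
- by move=> *; apply: p2.
- by move=> u v w a; apply: r3.
- by move=> u a b c; apply: p3.
- by move=> u v a b c; apply: r4.
- by move=> a b w u v; apply: p4.
- by move=> *; apply: r5.
- by move=> *; apply: p5.
Qed.

Section FirstComponents.

Context {S T : magmaType}.
Context {thetaS : S -> S -> S} {thetaT : T -> T -> T}.
Context {alpha : T -> S -> S} {beta : S -> T -> T}.
Context (quad : pentagon_quadruple thetaS thetaT alpha beta).

Lemma alpha_theta u a b : alpha u (thetaS a b) = thetaS a b.
Proof. by rewrite [RHS](pq_p5 quad a u). Qed.

(** The right-hand side of [pq_p2] does not mention the outer index on the left. *)
Lemma theta_theta_alpha a d b u c :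
  thetaS a (thetaS b (alpha u c)) = thetaS d (thetaS b (alpha u c)).
Proof.
have /= E1 := pq_p2 quad a b u u c; have /= E2 := pq_p2 quad d b u u c.
by rewrite E1 E2.
Qed.

(** The pentagon equation gives thetaS_{thetaS_a(b)} thetaS_{ab} = thetaS_b,
    and [pq_p2] allows any element as the outer index. *)
Lemma theta_theta_mull d a b u c :
  thetaS d (thetaS (a * b) (alpha u c)) = thetaS b (alpha u c).
Proof.
have [_ _ <-] := pentagon_mapP (pq_s quad) a b (alpha u c).
exact: theta_theta_alpha.
Qed.

(** The element thetaS_d(thetaS_{(aa)b}(alpha_u(c))) collapses in two ways,
    according to the bracketing of the index a a b. *)
Lemma theta_alpha_mull a b u c :
  thetaS (a * b) (alpha u c) = thetaS b (alpha u c).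
Proof.
have [mulA _ _] := pentagon_mapP (pq_s quad) a a b.
by rewrite -(theta_theta_mull a a) -mulA theta_theta_mull.
Qed.

Lemma theta_fix_theta_alpha d b u c :
  thetaS d (thetaS b (alpha u c)) = thetaS b (alpha u c).
Proof. by rewrite -{1}(theta_alpha_mull b) theta_theta_mull. Qed.

Lemma theta_alpha_twist b c u v :
  thetaS (alpha u b) (alpha (thetaT v (beta b u)) c) = thetaS b (alpha v c).
Proof.
have /= <- := pq_p2 quad b b v u c; exact: theta_fix_theta_alpha.
Qed.

(** Both sides are thetaS_x(d e), with x = a e on the left and x = a on the
    right, for e = thetaS_b(alpha_u(c)), which every thetaS_x fixes; [pq_p3]
    equates them because thetaS_d(alpha_u(e)) = e. *)
Lemma theta_mulr_absorb a d b u c (e := thetaS b (alpha u c)) :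
  thetaS (a * e) d * e = thetaS a d * e.
Proof.
have fixe x : thetaS x e = e by exact: theta_fix_theta_alpha.
have pentE x : thetaS x d * e = thetaS x (d * e).
  by have [_ <- _] := pentagon_mapP (pq_s quad) x d e; rewrite fixe.
by rewrite !pentE [RHS](pq_p3 quad a d e u) alpha_theta fixe.
Qed.

Lemma theta_mul_alpha a b c u v :
  thetaS a (alpha u b) * thetaS (a * alpha u b) (alpha (thetaT v (beta b u)) c)
  = thetaS (a * thetaS b (alpha v c))
      (alpha u b * alpha (thetaT v (beta b u)) c).
Proof.
have [_ <- _] := pentagon_mapP (pq_s quad) (a * thetaS b (alpha v c))
                   (alpha u b) (alpha (thetaT v (beta b u)) c).
by rewrite !(theta_alpha_mull _ (alpha u b)) theta_alpha_twist theta_mulr_absorb.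
Qed.

Definition fst3 (p : (S * T) * (S * T) * (S * T)) : S * S * S :=
  (p.1.1.1, p.1.2.1, p.2.1).

Lemma braid_fst_components (r := quadruple_map thetaS thetaT alpha beta) p :
  fst3 ((on23 r \o on12 r \o on23 r) p) = fst3 ((on12 r \o on23 r \o on12 r) p).
Proof.
have mulA (a b c : S) : a * b * c = a * (b * c).
  by have [] := pentagon_mapP (pq_s quad) a b c.
case: p => [[[a u] [b v]] [c w]]; rewrite /fst3 /on12 /on23 /=.
rewrite !alpha_theta -(pq_p4 quad); congr (_, _, _).
- have [_ _ ->] := pentagon_mapP (pq_s quad) a (alpha u b)
                     (alpha (thetaT v (beta b u)) c).
  by rewrite theta_alpha_twist theta_fix_theta_alpha.
- by rewrite theta_mul_alpha.
- by rewrite -mulA -(pq_p1 quad).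
Qed.

End FirstComponents.

Theorem theorem16 (S T : magmaType)
    (mulSA : associative (fun a b : S => (a * b)%g))
    (mulTA : associative (fun u v : T => (u * v)%g))
    (thetaS : S -> S -> S) (thetaT : T -> T -> T)
    (alpha : T -> S -> S) (beta : S -> T -> T)
    (quad : pentagon_quadruple thetaS thetaT alpha beta) :
  braid_solution (quadruple_map thetaS thetaT alpha beta).
Proof.
move=> [[[a u] [b v]] [c w]].
have := braid_fst_components quad (((a, u), (b, v)), (c, w)).
(* The dual quadruple sees the three points with both the legs and the
   coordinates exchanged, so its first components are the T-components. *)
have quadT := pentagon_quadruple_dual quad.
have := braid_fst_components quadT (((w, c), (v, b)), (u, a)).
rewrite /fst3 /on12 /on23 /= => -[T1 T2 T3] [S1 S2 S3].
by rewrite S1 S2 S3 T1 T2 T3.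
Qed.
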